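(* For every graph $H$ there exists $c=c(H)>0$ such that for any $H$-free graph $G$ on $N$ vertices and any positive integers $n_1,n_2$ satisfying $(\log n_1)(\log n_2) \leq c\log N$, $G$ contains a clique of size $n_1$ or an independent set of size $n_2$.
   Context: A graph is $H$-free if it does not contain $H$ as an induced subgraph. All logarithms are base $2$. *)

(* Defs.v *)
From HB Require Import structures.
From mathcomp Require Import all_boot all_order all_algebra.
From mathcomp Require Import reals exp.

Set Implicit Arguments.
Unset Strict Implicit.
Unset Printing Implicit Defensive.

Import Order.TTheory GRing.Theory Num.Theory.

Local Open Scope ring_scope.

Record sgraph := SGraph {
  vertex :> finType;
  adj : rel vertex;
  adj_sym : symmetric adj;
  adj_irrefl : irreflexive adj
}.

Definition induced_subgraph (H G : sgraph) : Prop :=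
  exists f : H -> G,
    injective f /\ forall x y : H, adj (f x) (f y) = adj x y.

Definition induced_free (H G : sgraph) : Prop := ~ induced_subgraph H G.

Definition clique (G : sgraph) (A : {set G}) : Prop :=
  forall x y : G, x \in A -> y \in A -> x != y -> adj x y.

Definition independent (G : sgraph) (A : {set G}) : Prop :=
  forall x y : G, x \in A -> y \in A -> ~~ adj x y.

Definition log2 (R : realType) (x : R) : R := ln x / ln 2.

(* Main.v *)
(** Suppose [n1 <= n2] (otherwise take complements) and put [n = n2 ^ 2].  The
    key point: if a set [U] of vertices has no independent set of size [n] and
    no copy of [H], then it contains [X] and [B], of size at least
    [|U| / n ^ C], with every vertex of [X] adjacent to all but a fraction
    [1 / n] of [B].  A clique in [X] of size at most [n / 2] then has at least
    [|B| / 2] common neighbours in [B], so each such step doubles the size of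
    the cliques found at the cost of a factor [n ^ O(C)] in [|U|];
    [O(log n1)] steps suffice.

    To prove the key point, assume there is no such pair and show by induction
    on [S] that a fraction at least [n ^ - O(1)] of all maps from the vertices
    of [H] to [U] is correct on [S].  To add a vertex [v] to [S]: many vertices
    [w] of [U] have degree at least [|U| / n ^ 3] in [U], since otherwise a
    greedy choice gives an independent set.  Applying induction inside the
    neighbourhoods of these [w] and double counting, many maps correct on [S]
    have an image with many common neighbours.  Since dense pairs are absent,
    resampling a single coordinate shows that for nearly all maps a positive
    fraction of these neighbours survives when nonadjacency to the images of
    the non-neighbours of [v] is imposed.  The surviving vertices are the
    possible images of [v]. *)

Require Import Defs.
From HB Require Import structures.
From mathcomp Require Import all_boot all_order all_algebra.
From mathcomp Require Import reals exp.
From mathcomp Require Import boolp zify lra ring.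
Set Implicit Arguments.
Unset Strict Implicit.
Unset Printing Implicit Defensive.

(** * Resampling one coordinate of a map *)

Section Resampling.
Variables (T V : finType).
Implicit Types (f : {ffun T -> V}) (U : {set V}) (P : pred {ffun T -> V}).

Definition upd f i x : {ffun T -> V} := [ffun j => if j == i then x else f j].

Definition maps U : {set {ffun T -> V}} := [set f in ffun_on (mem U)].

Lemma mapsP U f : reflect (forall i, f i \in U) (f \in maps U).
Proof. by rewrite inE; apply: ffun_onP. Qed.

Lemma card_maps U : #|maps U| = #|U| ^ #|T|.
Proof. by rewrite -card_ffun_on cardsE. Qed.

Lemma updE f i x j : upd f i x j = if j == i then x else f j.
Proof. by rewrite ffunE. Qed.

Lemma upd_same f i x : upd f i x i = x.
Proof. by rewrite updE eqxx. Qed.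

Lemma upd_other f i x j : j != i -> upd f i x j = f j.
Proof. by rewrite updE => /negbTE->. Qed.

(** Swapping [x] with [f i] is an involution on pairs [(f, x)], so a uniform map stays uniform when
    one coordinate is redrawn from [U]. *)
Lemma resample U i P :
  \sum_(f in maps U) #|[set x in U | P (upd f i x)]|
    = #|U| * #|[set f in maps U | P f]|.
Proof.
pose h (p : {ffun T -> V} * V) := (upd p.1 i p.2, p.1 i).
have hK : involutive h.
  move=> [f x]; rewrite /h /= upd_same; congr (_, _).
  by apply/ffunP=> j; rewrite !updE; case: eqP => [->|].
transitivity (\sum_(p | (p.1 \in maps U) && (p.2 \in U)) P (h p).1).
  rewrite -(pair_big (fun f => f \in maps U) (fun x => x \in U)
              (fun f x => nat_of_bool (P (upd f i x)))) /=.
  apply: eq_bigr => f _; rewrite -sum1_card big_mkcond [RHS]big_mkcond /=.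
  by apply: eq_bigr => x _; rewrite inE; case: (x \in U); case: (P _).
rewrite (reindex_inj (inv_inj hK)).
transitivity (\sum_(p | (p.1 \in maps U) && (p.2 \in U)) P p.1).
  apply: eq_big => [[f x]|p _]; last by rewrite hK.
  rewrite /h /=; apply/andP/andP => -[/mapsP fU xU]; split.
  - apply/mapsP=> j; have := fU j; rewrite updE.
    by case: eqP => [->|].
  - by have := fU i; rewrite upd_same.
  - by apply/mapsP=> j; rewrite updE; case: eqP.
  - exact: fU.
rewrite -(pair_big (fun f => f \in maps U) (fun x => x \in U)
            (fun f x => nat_of_bool (P f))) exchange_big /= sum_nat_const.
congr (_ * _); rewrite -sum1_card big_mkcond [RHS]big_mkcond /=.
by apply: eq_bigr => f _; rewrite [in RHS]inE; case: (f \in maps U); case: (P f).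
Qed.

Lemma resample_bound U i P m :
  (forall f, f \in maps U -> #|[set x in U | P (upd f i x)]| <= m) ->
  #|U| * #|[set f in maps U | P f]| <= m * #|U| ^ #|T|.
Proof.
move=> hm; rewrite -(resample U i P) mulnC -card_maps -sum_nat_const.
exact: leq_sum.
Qed.

End Resampling.

(** * Greedy independent sets, high degrees and dense pairs *)

Section Graph.
Variable G : sgraph.
Implicit Types (U W X B A : {set G}).

Definition nbr U x : {set G} := [set y in U | adj x y].
Definition conbr U x : {set G} := [set y in U | ~~ adj x y].

Lemma card_nbr_conbr U x : #|nbr U x| + #|conbr U x| = #|U|.
Proof.
rewrite -(cardsID [set y | adj x y] U); congr (_ + _); apply: eq_card => y;
  by rewrite !inE andbC.
Qed.

Lemma subset_nbr U x : nbr U x \subset U.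
Proof. by apply/subsetP=> y; rewrite inE => /andP[]. Qed.

Lemma subset_conbr U x : conbr U x \subset U.
Proof. by apply/subsetP=> y; rewrite inE => /andP[]. Qed.

Lemma nbrS U W x : U \subset W -> nbr U x \subset nbr W x.
Proof.
by move=> /subsetP UW; apply/subsetP=> y; rewrite !inE => /andP[/UW-> ->].
Qed.

(** Choosing a vertex and deleting it with its neighbours costs at most [d] vertices. *)
Lemma greedy_independent n d W :
  0 < d -> (forall x, x \in W -> #|nbr W x| < d) -> n * d <= #|W| ->
  exists A, [/\ A \subset W, independent A & #|A| = n].
Proof.
move=> d0; elim: n W => [|n IH] W hd hn.
  by exists set0; rewrite sub0set cards0; split=> // x y; rewrite inE.
have [W0|[x xW]] := set_0Vmem W.
  by move: hn; rewrite W0 cards0 leqn0 muln_eq0 (gtn_eqF d0).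
pose W' := conbr W x :\ x.
have W'W : W' \subset W := subset_trans (subsetDl _ _) (subset_conbr W x).
have [||A [AW' indA cA]] := IH W'.
- move=> y yW'; apply: leq_ltn_trans (hd y (subsetP W'W _ yW')).
  exact/subset_leq_card/nbrS.
- have := card_nbr_conbr W x; have := hd x xW.
  have := cardsD1 x (conbr W x); rewrite -/W' inE xW adj_irrefl /=; lia.
have AP y : y \in A -> [/\ y != x, y \in W & ~~ adj x y].
  by move=> /(subsetP AW'); rewrite !inE => /and3P[].
exists (x |: A); split.
- by rewrite subUset sub1set xW (subset_trans AW').
- move=> y z; rewrite !inE => /orP[/eqP->|yA] /orP[/eqP->|zA].
  + by rewrite adj_irrefl.
  + by have [] := AP z zA.
  + by rewrite adj_sym; have [] := AP y yA.
  + exact: indA.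
- by rewrite cardsU1 cA; case: (boolP (x \in A)) => // /AP[]; rewrite eqxx.
Qed.

Definition indep_lt n U :=
  forall A, A \subset U -> independent A -> #|A| < n.

Lemma indep_ltS n U W : U \subset W -> indep_lt n W -> indep_lt n U.
Proof. by move=> UW h A AU; apply: h; apply: subset_trans UW. Qed.

Lemma many_high_degree n U : 1 < n -> indep_lt n U -> n ^ 3 <= #|U| ->
  #|U| <= n * #|[set w in U | #|U| <= n ^ 3 * #|nbr U w|]|.
Proof.
move=> n1 hU nU; set Hi := [set w in U | _]; rewrite leqNgt; apply/negP=> hHi.
pose d := (#|U| %/ n ^ 3).+1; pose W := U :\: Hi.
have n30 : 0 < n ^ 3 by rewrite expn_gt0; lia.
have cW : #|Hi| + #|W| = #|U|.
  rewrite -(cardsID Hi U); congr (_ + _); apply: eq_card => y.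
  by rewrite !inE; case: (y \in U).
have [|||A [AW indA cA]] := @greedy_independent n d W.
- by [].
- move=> x; rewrite !inE => /andP[+ xU]; rewrite xU -ltnNge => h.
  rewrite ltnS leq_divRL // mulnC; apply: leq_trans (ltnW h).
  rewrite leq_mul2l subset_leq_card ?orbT //; exact/nbrS/subsetDl.
(* Since [4 * n <= n ^ 3], both [n * q] and [n] are at most a quarter of [|U|], while [W] keeps at
   least half of [U]. *)
- have := leq_trunc_div #|U| (n ^ 3); rewrite /d; set q := _ %/ _ => hq.
  have : 4 * n * q <= #|U|.
    apply: leq_trans hq; rewrite mulnC leq_mul2l !expnS expn0; nia.
  have : 4 * n <= #|U| by apply: leq_trans nU; rewrite !expnS expn0; nia.
  nia.
have := hU A (subset_trans AW (subsetDl _ _)) indA; by rewrite cA ltnn.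
Qed.

(* The sets [X] and [B] of a dense pair may overlap. *)
Definition dense_pair n X B := forall x, x \in X -> n * #|conbr B x| <= #|B|.

Definition no_dense n m U := forall X B, X \subset U -> B \subset U ->
  m <= #|X| -> m <= #|B| -> ~ dense_pair n X B.

Lemma no_denseS n m U W : U \subset W -> no_dense n m W -> no_dense n m U.
Proof.
by move=> UW h X B XU BU; apply: h; [apply: subset_trans UW|apply: subset_trans UW].
Qed.

End Graph.

(** * Counting maps that are correct on [S] *)

Section Copies.
Variables (G : sgraph) (T : finType) (e : rel T).
Hypotheses (e_sym : symmetric e) (e_irr : irreflexive e).
Implicit Types (U : {set G}) (S : {set T}) (f : {ffun T -> G}).

Definition respects S f :=
  [forall i in S, forall j in S, adj (f i) (f j) == e i j].

Lemma respectsP S f :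
  reflect {in S &, forall i j, adj (f i) (f j) = e i j} (respects S f).
Proof.
apply: (iffP forall_inP) => [h i j iS jS|h i iS].
  by have /forall_inP/(_ j jS)/eqP := h i iS.
by apply/forall_inP=> j jS; rewrite h.
Qed.

Definition copies S U := [set f in maps T U | respects S f].

Lemma copiesE S U f : (f \in copies S U) = (f \in maps T U) && respects S f.
Proof. by rewrite inE. Qed.

(** Candidate images of [v]; nonadjacency is required only along [r], so that it can be imposed one
    vertex at a time. *)
Definition ext S v U f (r : seq T) : {set G} :=
  [set w in U | [forall i in S, e v i ==> adj w (f i)]
                && all (fun i => ~~ adj w (f i)) r].

Lemma ext_cons S v U f i r : ext S v U f (i :: r) = conbr (ext S v U f r) (f i).
Proof.
apply/setP=> w; rewrite !inE /= [adj (f i) w]adj_sym.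
by case: (w \in U) => //=; case: [forall _ in _, _] => //=; rewrite andbC.
Qed.

Lemma ext_upd S v U f i x r :
  i \notin r -> ~~ e v i -> ext S v U (upd f i x) r = ext S v U f r.
Proof.
move=> ir evi; apply/setP=> w; rewrite !inE; congr (_ && (_ && _)).
  apply: eq_forallb_in => j jS; rewrite updE; case: eqP => // ->.
  by rewrite (negbTE evi).
apply: eq_in_all => j jr; rewrite upd_other //.
by apply: contraNneq ir => <-.
Qed.

(** Induction on [r]. The set [ext S v U f r] does not depend on [f i], so once the other
    coordinates are fixed, the values of [f i] that newly fail are adjacent to all but a fraction
    [1 / n] of this set. More than [m] such values would give a dense pair. *)
Lemma few_failures S v U n m q r :
  no_dense n m U -> q * n ^ size r * m <= #|U| -> 0 < q * n ^ size r ->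
  uniq r -> all (fun i => ~~ e v i) r ->
  #|U| * #|[set f in maps T U | (#|U| <= q * #|ext S v U f [::]|)
                   && ~~ (#|U| <= q * n ^ size r * #|ext S v U f r|)]|
  <= size r * m * #|U| ^ #|T|.
Proof.
move=> hU; elim: r => [|i r IH] hm q0.
  move=> _ _; rewrite (_ : [set f in _ | _] = set0) ?cards0 ?muln0 //.
  by apply/setP=> f; rewrite !inE expn0 muln1 andbN andbF.
move=> /= /andP[ir ur] /andP[evi er].
set Q := q * n ^ size r.
have QnE : q * n ^ (size r).+1 = Q * n by rewrite expnSr mulnA.
move: hm q0; rewrite /= QnE => hm q0.
have [Q0 n0] : 0 < Q /\ 0 < n by move: q0; rewrite muln_gt0 => /andP[].
have {}IH := IH _ Q0 ur er; rewrite -/Q in IH.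
pose P f := (#|U| <= Q * #|ext S v U f r|)
            && ~~ (#|U| <= Q * n * #|ext S v U f (i :: r)|).
have stepP : #|U| * #|[set f in maps T U | P f]| <= m * #|U| ^ #|T|.
  apply: (@resample_bound _ _ U i P m) => f fU; rewrite leqNgt; apply/negP=> hX.
  set X := [set x in U | _] in hX.
  have XP x : x \in X -> [/\ x \in U, #|U| <= Q * #|ext S v U f r|
      & ~~ (#|U| <= Q * n * #|conbr (ext S v U f r) x|)].
    by rewrite inE /P ext_cons upd_same ext_upd // => /and3P[].
  have [x0 /XP[_ hB _]] : exists x, x \in X.
    by apply/set0Pn; rewrite -card_gt0; apply: leq_ltn_trans hX.
  apply: (hU X (ext S v U f r)) (ltnW hX) _ _.
  - by apply/subsetP=> x /XP[].
  - by apply/subsetP=> x; rewrite inE => /andP[].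
  - have := leq_trans hm hB; rewrite -mulnA leq_pmul2l //.
    apply: leq_trans; exact: leq_pmull.
  - move=> x /XP[_ _]; rewrite -ltnNge => /ltnW h.
    have := leq_trans h hB; by rewrite -mulnA leq_pmul2l.
apply: leq_trans (_ : _ <= (size r * m + m) * #|U| ^ #|T|) _; last first.
  by rewrite mulSn addnC.
rewrite mulnDl; apply: leq_trans (leq_add (IH _) stepP); last first.
  by apply: leq_trans hm; rewrite leq_mul2r leq_pmulr ?orbT.
rewrite -mulnDr leq_mul2l; apply/orP; right.
apply: leq_trans (leq_card_setU _ _); apply/subset_leq_card/subsetP=> f.
rewrite !inE /P => /and3P[-> -> h] /=.
by case: leqP => //= _; rewrite ltnNge.
Qed.

(** Double counting of pairs [(w, f)] where [f] is correct on [S] and maps into the neighbourhood of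
    [w]. Maps with few candidates for [v] contribute at most half of the pairs. *)
Lemma many_extendable S v U n m a q : 1 < n -> 0 < m -> indep_lt n U ->
  (forall W : {set G}, W \subset U -> n ^ a * m <= #|W| ->
     #|W| ^ #|T| <= n ^ a * #|copies S W|) ->
  n ^ (a + 3) * m <= #|U| ->
  q = n ^ (3 * #|T| + a + 2) ->
  #|U| ^ #|T|
    <= q * #|[set f in copies S U | #|U| <= q * #|ext S v U f [::]|]|.
Proof.
move=> n1 m0 indU IH hU; set k := #|T|; move=> qdef.
set Good := [set f in _ | _].
have n0 : 0 < n by lia.
(* The loss in the pair count: [n ^ (3 * k)] from shrinking [U] to a neighbourhood, [n ^ a] from
   induction, [n] from keeping only [w] of high degree. The further factor [n >= 2] in [q] provides
   the half. *)
pose p := n ^ (3 * k + a + 1).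
have qE : q = n * p by rewrite qdef /p addnS expnS.
have U0 : 0 < #|U| by apply: leq_trans hU; rewrite muln_gt0 expn_gt0 n0.
have hU3 : n ^ 3 * (n ^ a * m) <= #|U|.
  by rewrite mulnA -expnD addnC.
have n3U : n ^ 3 <= #|U|.
  by apply: leq_trans hU3; rewrite leq_pmulr // muln_gt0 expn_gt0 n0.
pose com f := [set w in U | [forall i, adj w (f i)]].
pose Hi := [set w in U | #|U| <= n ^ 3 * #|nbr U w|].
have sumE : \sum_(w in Hi) #|copies S (nbr U w)|
    <= \sum_(f in copies S U) #|com f|.
  have -> : \sum_(f in copies S U) #|com f|
      = \sum_(w in U) #|[set f in copies S U | [forall i, adj w (f i)]]|.
    transitivity (\sum_(f in copies S U) \sum_(w in U) [forall i, adj w (f i)]).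
      apply: eq_bigr => f _; rewrite -sum1_card big_mkcond [RHS]big_mkcond /=.
      by apply: eq_bigr => w _; rewrite inE; case: (w \in U); case: [forall _, _].
    rewrite exchange_big /=; apply: eq_bigr => w _.
    rewrite -sum1_card big_mkcond [RHS]big_mkcond /=; apply: eq_bigr => f _.
    by rewrite [in RHS]inE; case: (f \in copies S U); case: [forall _, _].
  rewrite [X in _ <= X]big_mkcond [X in X <= _]big_mkcond /=.
  apply: leq_sum => w _; rewrite inE; case: (w \in U) => //=.
  case: ifP => // _; apply/subset_leq_card/subsetP=> f.
  rewrite copiesE => /andP[/mapsP fN rf]; rewrite inE copiesE rf andbT.
  apply/andP; split.
    apply/mapsP=> i; exact: (subsetP (subset_nbr U w)).
  by apply/forallP=> i; have := fN i; rewrite inE => /andP[].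
have HiP w : w \in Hi -> #|U| ^ k <= n ^ (3 * k + a) * #|copies S (nbr U w)|.
  rewrite inE => /andP[_ hw].
  rewrite expnD -mulnA; apply: leq_trans (_ : _ <= n ^ (3 * k) * #|nbr U w| ^ k) _.
    by rewrite expnM -expnMn; case: (k) => // k'; rewrite leq_exp2r.
  rewrite leq_pmul2l ?expn_gt0 ?n0 //; apply: IH (subset_nbr U w) _.
  by have := leq_trans hU3 hw; rewrite leq_pmul2l // expn_gt0 n0.
set Sg := \sum_(f in copies S U) #|com f| in sumE.
have lowS : #|U| * #|U| ^ k <= p * Sg.
  have := many_high_degree n1 indU n3U; rewrite -/Hi => hHi.
  apply: leq_trans (_ : _ <= n * #|Hi| * #|U| ^ k) _; first by rewrite leq_mul2r hHi orbT.
  rewrite /p addn1 expnS -!mulnA leq_pmul2l //.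
  apply: leq_trans (_ : _ <= n ^ (3 * k + a) * \sum_(w in Hi) #|copies S (nbr U w)|) _.
    by rewrite big_distrr /= -sum_nat_const; apply: leq_sum => w /HiP.
  by rewrite leq_mul2l sumE orbT.
have highS : q * Sg <= q * #|Good| * #|U| + #|U| ^ k * #|U|.
  rewrite /Sg big_distrr /=.
  apply: leq_trans (_ : _ <= \sum_(f in copies S U)
                               (q * #|U| * (f \in Good) + #|U|)) _.
    apply: leq_sum => f fS; have comU : #|com f| <= #|U|.
      by apply/subset_leq_card/subsetP=> w; rewrite inE => /andP[].
    have comE : #|com f| <= #|ext S v U f [::]|.
      apply/subset_leq_card/subsetP=> w; rewrite !inE => /andP[-> /forallP h] /=.
      by rewrite andbT; apply/forall_inP=> i _; rewrite h implybT.
    rewrite [f \in Good]inE fS /=.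
    have [_|h] := leqP #|U| (q * #|ext S v U f [::]|).
      by rewrite muln1; apply: leq_trans (leq_addr _ _); rewrite leq_mul2l comU orbT.
    rewrite muln0 add0n; apply: leq_trans (ltnW h); by rewrite leq_mul2l comE orbT.
  rewrite big_split /= -big_distrr /= leq_add //.
    rewrite mulnAC leq_mul2r leq_mul2l -[#|Good|]sum1_card big_mkcond.
    rewrite [X in _ <= X]big_mkcond /=.
    by rewrite leq_sum ?orbT // => f _; case: (f \in Good); case: ifP.
  rewrite sum_nat_const leq_mul2r -card_maps subset_leq_card ?orbT //.
  by apply/subsetP=> f; rewrite copiesE => /andP[].
rewrite -(leq_pmul2r U0).
have : 2 * (p * Sg) <= q * Sg by rewrite qE -!mulnA leq_mul2r n1 orbT.
move: lowS highS; rewrite [#|U| * _]mulnC; lia.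
Qed.

(** One factor [q = n ^ (3 * k + a + 2)] is lost in the number of maps and one in the number of
    candidates; [k] pays for the nonadjacencies and [1] for discarding bad maps. *)
Definition next_exp k a := 2 * (3 * k + a + 2) + k + 1.

(** After the failures are discarded, each remaining map has many values for [v]. Resampling at [v]
    turns these pairs into maps correct on [v |: S]. *)
Lemma copies_step S v U n m a : v \notin S -> 1 < n -> 0 < m ->
  indep_lt n U -> no_dense n m U ->
  (forall W : {set G}, W \subset U -> n ^ a * m <= #|W| ->
     #|W| ^ #|T| <= n ^ a * #|copies S W|) ->
  n ^ next_exp #|T| a * m <= #|U| ->
  #|U| ^ #|T| <= n ^ next_exp #|T| a * #|copies (v |: S) U|.
Proof.
set k := #|T| => vS n1 m0 indU dU IH hU.
have n0 : 0 < n by lia.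
have le_exp b c : b <= c -> n ^ b <= n ^ c by move=> ?; rewrite leq_exp2l.
have hUb b : b <= next_exp k a -> n ^ b * m <= #|U|.
  by move=> /le_exp h; apply: leq_trans hU; rewrite leq_mul2r h orbT.
have U0 : 0 < #|U| by apply: leq_trans (hUb 0 _); rewrite ?mul1n.
have [b bE] : exists b, b = 3 * k + a + 2 by exists (3 * k + a + 2).
have neE : next_exp k a = 2 * b + k + 1 by rewrite bE.
pose q := n ^ b.
have q0 : 0 < q by rewrite expn_gt0 n0.
have nk0 j : 0 < n ^ j by rewrite expn_gt0 n0.
have := @many_extendable S v U n m a q n1 m0 indU IH.
set Good := [set f in _ | _] => hGood.
have {}hGood : #|U| ^ k <= q * #|Good|.
  by apply: hGood; rewrite /q ?bE //; apply: hUb; rewrite /next_exp; lia.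
pose K := [set i in S | ~~ e v i]; pose r := enum K.
have rk : size r <= k by rewrite -cardE max_card.
have := @few_failures S v U n m q r dU.
set Bad := [set f in _ | _] => hBad.
have {}hBad : #|U| * #|Bad| <= size r * m * #|U| ^ k.
  apply: hBad.
  - rewrite /q -expnD; apply: hUb.
    rewrite neE mul2n -addnn -!addnA leq_add2l addnCA.
    exact: leq_trans rk (leq_addr _ _).
  - by rewrite muln_gt0 q0 nk0.
  - exact: enum_uniq.
  - by apply/allP=> i; rewrite mem_enum inE => /andP[].
(* Here [2 <= n], [size r <= k < n ^ k] and [n ^ (k + 1 + b) * m <= |U|], so [Bad] takes at most
   half of the lower bound on [Good]. *)
have {}hBad : 2 * (q * #|Bad|) <= #|U| ^ k.
  rewrite -(leq_pmul2l U0).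
  apply: leq_trans (_ : _ <= 2 * q * (size r * m * #|U| ^ k)) _.
    by rewrite mulnCA [#|U| * _]mulnCA mulnA leq_mul2l hBad orbT.
  rewrite !mulnA leq_mul2r; apply/orP; right.
  apply: leq_trans (hUb (k + 1 + b) _); last by rewrite neE; lia.
  rewrite leq_mul2r [2 * q * _]mulnAC !expnD leq_mul2r; apply/orP; right.
  apply/orP; right; rewrite mulnC leq_mul // ?expn1 //.
  apply: leq_trans rk (leq_trans (ltnW (ltn_expl k n1)) _) => //.
pose Good2 := Good :\: Bad.
have cG : #|Good| <= #|Good2| + #|Bad|.
  by rewrite -(cardsID Bad Good) addnC leq_add2l subset_leq_card ?subsetIr.
have {}hGood : #|U| ^ k <= n * q * #|Good2|.
  apply: leq_trans (_ : 2 * (q * #|Good2|) <= _); last by rewrite -mulnA leq_mul2r n1 orbT.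
  by have := leq_mul (leqnn q) cG; rewrite mulnDr; lia.
have Good2P f : f \in Good2 ->
    [/\ f \in copies S U & #|U| <= q * n ^ k * #|ext S v U f r|].
  rewrite !inE => /andP[/nandP h /andP[/andP[fU rf] hf]].
  rewrite fU rf; split=> //.
  case: h; first by rewrite fU.
  rewrite hf negbK => /leq_trans; apply.
  by rewrite leq_mul2r leq_mul2l le_exp ?orbT.
have extP f w : f \in copies S U -> w \in ext S v U f r ->
    respects (v |: S) (upd f v w).
  rewrite copiesE => /andP[_ /respectsP rf]; rewrite inE => /and3P[wU /forall_inP wa /allP wn].
  have wE j : j \in S -> adj w (f j) = e v j.
    move=> jS; case: (boolP (e v j)) => evj; first by have := wa j jS; rewrite evj.
    by apply/negbTE/wn; rewrite mem_enum inE jS.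
  have Sv j : j \in S -> j != v by move=> jS; apply: contraNneq vS => <-.
  apply/respectsP=> i j; rewrite !inE => /orP[/eqP->|iS] /orP[/eqP->|jS].
  - by rewrite adj_irrefl e_irr.
  - by rewrite upd_same upd_other ?Sv // wE.
  - by rewrite upd_same upd_other ?Sv // adj_sym wE // e_sym.
  - by rewrite !upd_other ?Sv // rf.
have hres : \sum_(f in Good2) #|ext S v U f r| <= #|U| * #|copies (v |: S) U|.
  rewrite -(resample U v (respects (v |: S))).
  rewrite [X in X <= _]big_mkcond [X in _ <= X]big_mkcond /=.
  apply: leq_sum => f _; case: ifP => // /Good2P[fS _].
  move: (fS); rewrite copiesE => /andP[-> _].
  apply/subset_leq_card/subsetP=> w wE; rewrite inE extP // andbT.
  by move: wE; rewrite inE => /andP[].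
have {}hres : #|Good2| <= q * n ^ k * #|copies (v |: S) U|.
  rewrite -(leq_pmul2l U0) mulnC.
  apply: leq_trans (_ : _ <= q * n ^ k * \sum_(f in Good2) #|ext S v U f r|) _.
    by rewrite big_distrr /= -sum_nat_const; apply: leq_sum => f /Good2P[].
  by rewrite mulnCA leq_mul2l hres orbT.
apply: leq_trans hGood _; apply: leq_trans (leq_mul (leqnn _) hres) _.
rewrite !mulnA leq_mul2r; apply/orP; right.
by rewrite -{1}(expn1 n) /q -!expnD leq_exp2l // neE; lia.
Qed.

Lemma many_copies n m S U : 1 < n -> 0 < m -> indep_lt n U -> no_dense n m U ->
  let a := iter #|S| (next_exp #|T|) 0 in
  n ^ a * m <= #|U| -> #|U| ^ #|T| <= n ^ a * #|copies S U|.
Proof.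
move=> n1 m0; move cS : #|S| => s; elim: s S cS U => [|s IH] S cS U indU dU a hU.
  have -> : copies S U = maps T U.
    apply/setP=> f; rewrite inE; case: (f \in _) => //=; apply/respectsP=> i j.
    by rewrite (cards0_eq cS) inE.
  by rewrite card_maps mul1n.
have [v vS] : exists v, v \in S by apply/set0Pn; rewrite -card_gt0 cS.
rewrite -(setD1K vS); apply: (@copies_step (S :\ v) v U n m) hU => //.
  by rewrite !inE eqxx.
move=> W WU; apply: IH.
- by move: cS; rewrite (cardsD1 v) vS => -[].
- exact: indep_ltS WU indU.
- exact: no_denseS WU dU.
Qed.

End Copies.

(** * From dense pairs to cliques *)

Definition copy_exp k := iter k (next_exp k) 0.

Lemma dense_pair_exists (G : sgraph) (T : finType) (e : rel T) n m (U : {set G}) :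
  symmetric e -> irreflexive e -> 1 < n -> 0 < m -> indep_lt n U ->
  (forall f : T -> G, ~ forall i j, adj (f i) (f j) = e i j) ->
  n ^ copy_exp #|T| * m <= #|U| ->
  exists X B : {set G}, [/\ X \subset U, B \subset U, m <= #|X|, m <= #|B|
                          & dense_pair n X B].
Proof.
move=> es ei n1 m0 indU noT hU; apply: contrapT => noXB.
have dU : no_dense n m U.
  by move=> X B XU BU mX mB d; apply: noXB; exists X, B.
have := many_copies es ei n1 m0 (S := [set: T]) indU dU.
rewrite /= cardsT => /(_ hU) h.
have U0 : 0 < #|U|.
  by apply: leq_trans hU; rewrite muln_gt0 m0 expn_gt0 (ltnW n1).
have : 0 < #|copies e [set: T] U|.
  have : 0 < #|U| ^ #|T| by rewrite expn_gt0 U0.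
  by move=> /leq_trans/(_ h); rewrite muln_gt0 => /andP[].
rewrite card_gt0 => /set0Pn[f]; rewrite inE => /andP[_ /respectsP rf].
by apply: (noT f) => i j; apply: rf; rewrite inE.
Qed.

Lemma cliqueU (G : sgraph) (A B : {set G}) : clique A -> clique B ->
  {in A & B, forall x y, adj x y} -> clique (A :|: B).
Proof.
move=> cA cB cAB x y; rewrite !inE => /orP[xA|xB] /orP[yA|yB] xy.
- exact: cA.
- exact: cAB.
- by rewrite adj_sym; apply: cAB.
- exact: cB.
Qed.

(** In a dense pair, a clique [Q] found in [X] joins one of equal size found in the common
    neighbourhood of [Q] in [B]. *)
Lemma clique_pow2 (G : sgraph) (T : finType) (e : rel T) n j (U : {set G}) :
  symmetric e -> irreflexive e -> 1 < n -> indep_lt n U ->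
  (forall f : T -> G, ~ forall i j, adj (f i) (f j) = e i j) ->
  2 ^ j <= n -> n ^ ((copy_exp #|T|).+1 * j) <= #|U| ->
  exists Q : {set G}, [/\ Q \subset U, clique Q & #|Q| = 2 ^ j].
Proof.
move=> es ei n1 + noT; set b := (copy_exp _).+1.
have n0 : 0 < n by lia.
elim: j U => [|j IH] U indU jn hU.
  have /set0Pn[x xU] : U != set0 by rewrite -card_gt0; apply: leq_trans hU; rewrite muln0.
  exists [set x]; rewrite sub1set cards1; split=> // y z.
  by rewrite !inE => /eqP-> /eqP->; rewrite eqxx.
have j1n : 2 ^ j <= n by apply: leq_trans jn; rewrite leq_exp2l.
(* The [+ 1] in the exponent of the size bound, matched by the successor in [b], absorbs the halving
   of [B] below. *)
have [||X [B [XU BU mX mB dXB]]] :=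
    @dense_pair_exists G T e n (n ^ (b * j).+1) U es ei n1 _ indU noT.
- by rewrite expn_gt0 n0.
- by rewrite -expnD; apply: leq_trans hU; rewrite leq_exp2l // mulnS addnS -addSn.
have [||Q [QX cQ sQ]] := IH X _ j1n.
- exact: indep_ltS XU indU.
- by apply: leq_trans mX; rewrite leq_exp2l.
pose B' := B :\: \bigcup_(x in Q) conbr B x.
have B'B : B' \subset B := subsetDl _ _.
have hB' : n ^ (b * j) <= #|B'|.
  (* As [2 ^ j.+1 <= n], the vertices of [B] missed by some vertex of [Q] make up at most half of
     [B]. *)
  have hS : n * #|\bigcup_(x in Q) conbr B x| <= 2 ^ j * #|B|.
    rewrite -sQ -sum_nat_const.
    apply: leq_trans (_ : _ <= n * \sum_(x in Q) #|conbr B x|) _.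
      rewrite leq_mul2l; apply/orP; right.
      elim/big_rec2: _ => [|x A d _ IHA]; first by rewrite cards0.
      by apply: leq_trans (leq_card_setU _ _) _; rewrite leq_add2l.
    rewrite big_distrr /=; apply: leq_sum => x xQ; apply: dXB.
    exact: (subsetP QX).
  have := cardsID (\bigcup_(x in Q) conbr B x) B; rewrite -/B'.
  have : #|B :&: \bigcup_(x in Q) conbr B x| <= #|\bigcup_(x in Q) conbr B x|.
    by rewrite subset_leq_card // subsetIr.
  move: mB jn hS; rewrite !expnS.
  set x := #|\bigcup_(x in Q) _|; set y := #|_ :&: _|; set z := n ^ _; set t := 2 ^ j.
  move=> mB jn hS yx hB; suff : 2 * x <= #|B| by nia.
  rewrite -(leq_pmul2l n0); nia.
have [|Q' [QB' cQ' sQ']] := IH B' _ j1n hB'.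
  exact: indep_ltS (subset_trans B'B BU) indU.
have QQ' : {in Q & Q', forall x y, adj x y}.
  move=> x y xQ /(subsetP QB'); rewrite inE => /andP[/bigcupP h yB].
  by apply/negPn/negP=> nxy; apply: h; exists x; rewrite // inE yB.
exists (Q :|: Q'); split.
- by rewrite subUset (subset_trans QX) // (subset_trans QB') // (subset_trans B'B).
- exact: cliqueU.
- rewrite cardsU sQ sQ' (_ : Q :&: Q' = set0) ?cards0 ?subn0 ?addnn -?mul2n -?expnS //.
  apply/setP=> x; rewrite !inE; apply/andP=> -[xQ xQ'].
  by have := QQ' x x xQ xQ'; rewrite adj_irrefl.
Qed.

(* Attaching a pendant vertex to every vertex of [H] makes any map that preserves
   adjacency and nonadjacency injective on [H]. *)
Definition pendant (H : sgraph) : rel (bool * H) := fun p q =>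
  if p.1 then ~~ q.1 && (p.2 == q.2)
  else if q.1 then p.2 == q.2 else adj p.2 q.2.

Lemma pendant_sym (H : sgraph) : symmetric (@pendant H).
Proof.
move=> [[] x] [[] y]; rewrite /pendant //= 1?eq_sym //; exact: adj_sym.
Qed.

Lemma pendant_irrefl (H : sgraph) : irreflexive (@pendant H).
Proof. by move=> [[] x]; rewrite /pendant //= adj_irrefl. Qed.

Lemma pendant_induced (H G : sgraph) (f : bool * H -> G) :
  (forall p q, adj (f p) (f q) = pendant p q) -> induced_subgraph H G.
Proof.
move=> hf; exists (fun x => f (false, x)); split=> [x y fxy|x y]; last exact: hf.
have := hf (false, x) (true, x); rewrite fxy hf /pendant /= eqxx.
by move/eqP.
Qed.

Lemma sub_card_exists (V : finType) (A : {set V}) n :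
  n <= #|A| -> exists2 B : {set V}, B \subset A & #|B| = n.
Proof.
elim: n => [|n IH] h; first by exists set0; rewrite ?sub0set ?cards0.
have [B BA cB] := IH (ltnW h).
have /set0Pn[x] : A :\: B != set0.
  rewrite setD_eq0; apply: contraTN h => /subset_leq_card; rewrite cB; lia.
rewrite inE => /andP[xB xA]; exists (x |: B); last by rewrite cardsU1 xB cB.
by rewrite subUset sub1set xA.
Qed.

(** The pendant vertices double the order of [H]. *)
Definition ramsey_exp h := (copy_exp (2 * h)).+1.

Lemma clique_or_independent (H G : sgraph) n1 n2 :
  induced_free H G -> 1 < n1 -> n1 <= n2 ->
  n2 ^ (2 * (ramsey_exp #|H| * up_log 2 n1)) <= #|G| ->
  (exists A : {set G}, clique A /\ #|A| = n1) \/
  (exists A : {set G}, independent A /\ #|A| = n2).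
Proof.
move=> HG n1_gt1 n12 hG.
have [|noind] := pselect (exists A : {set G}, independent A /\ #|A| = n2).
  by right.
left; have n2_gt1 : 1 < n2 := leq_trans n1_gt1 n12.
have /andP[jlo jhi] := up_log_bounds (isT : 1 < 2) n1_gt1.
have [|||||||Q [_ cQ sQ]] :=
    @clique_pow2 G (bool * H)%type (@pendant H) (n2 ^ 2) (up_log 2 n1) [set: G].
- exact: pendant_sym.
- exact: pendant_irrefl.
- by rewrite -[1]/(1 ^ 2) ltn_exp2r.
- move=> A _ indA; rewrite ltnNge; apply/negP=> hA; apply: noind.
  have [|B BA cB] := @sub_card_exists _ A n2.
    by apply: leq_trans hA; rewrite -[X in X <= _]expn1 leq_exp2l.
  by exists B; split=> // x y xB yB; apply: indA; apply: (subsetP BA).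
- by move=> f /pendant_induced/HG.
(* Rounding [n1] up to a power of two stays below [2 * n1 <= n2 ^ 2], which is why [n2] is
   squared. *)
- move: jlo; case: (up_log 2 n1) => [|j] /=; first by rewrite expn_gt0; lia.
  by rewrite expnS expnS expn1; nia.
- by rewrite -expnM cardsT card_prod card_bool.
have [|B BQ cB] := @sub_card_exists _ Q n1; first by rewrite sQ.
by exists B; split=> // x y xB yB; apply: cQ; apply: (subsetP BQ).
Qed.

(** * Complements, which exchange cliques and independent sets *)

Section Complement.
Variable G : sgraph.

Definition coadj : rel G := fun x y => (x != y) && ~~ adj x y.

Lemma coadj_sym : symmetric coadj.
Proof. by move=> x y; rewrite /coadj eq_sym adj_sym. Qed.

Lemma coadj_irrefl : irreflexive coadj.
Proof. by move=> x; rewrite /coadj eqxx. Qed.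

Definition compl := SGraph coadj_sym coadj_irrefl.

Lemma compl_clique (A : {set compl}) : clique A -> independent (A : {set G}).
Proof.
move=> cA x y xA yA; have [->|xy] := eqVneq x y; first by rewrite adj_irrefl.
by have /andP[] := cA x y xA yA xy.
Qed.

Lemma compl_independent (A : {set compl}) : independent A -> clique (A : {set G}).
Proof.
by move=> iA x y xA yA xy; have := iA x y xA yA; rewrite /= /coadj xy negbK.
Qed.

End Complement.

Lemma compl_free (H G : sgraph) :
  induced_free H G -> induced_free (compl H) (compl G).
Proof.
move=> HG [f [finj hf]]; apply: HG; exists f; split=> // x y.
have [->|xy] := eqVneq x y; first by rewrite !adj_irrefl.
have := hf x y; rewrite /= /coadj (inj_eq finj) xy /=.
by case: (adj _ _); case: (adj _ _).
Qed.

(** * Logarithmic form of the bound and conclusion *)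

Import Order.TTheory GRing.Theory Num.Theory.
Local Open Scope ring_scope.

(** With [j = up_log 2 n1], the bound [2 ^ j <= n1 ^ 2] gives [j <= 2 * log n1], so the left side
    has logarithm at most [4 * b * log n1 * log n2]. *)
Lemma pow_le_of_log (R : realType) b (n1 n2 N : nat) :
  (1 < n1)%N -> (1 < n2)%N -> (0 < N)%N -> (0 < b)%N ->
  log2 (n1%:R : R) * log2 (n2%:R : R) <= (4 * b)%:R^-1 * log2 (N%:R : R) ->
  (n2 ^ (2 * (b * up_log 2 n1)) <= N)%N.
Proof.
move=> n1_gt1 n2_gt1 N0 b0 h.
have n1p : (0 : R) < n1%:R by rewrite ltr0n ltnW.
have n2p : (0 : R) < n2%:R by rewrite ltr0n ltnW.
have Np : (0 : R) < N%:R by rewrite ltr0n.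
have l2 : 0 < ln (2 : R) by rewrite ln_gt0 // ltr1n.
have ln2 : 0 < ln (n2%:R : R) by rewrite ln_gt0 // ltr1n.
set j := up_log 2 n1.
have jn : (2 ^ j <= n1 ^ 2)%N.
  have /andP[] := up_log_bounds (isT : 1 < 2)%N n1_gt1; rewrite -/j.
  by case: (j) => [|i] /=; rewrite ?expn0 ?expnS ?expn1; nia.
have hj : j%:R * ln (2 : R) <= 2 * ln (n1%:R : R).
  rewrite !mulr_natl -!lnXn // -!natrX ler_ln ?ler_nat ?posrE ?ltr0n ?expn_gt0 //.
  by rewrite ltnW.
rewrite -(@ler_nat R) -ler_ln ?posrE //; last by rewrite ltr0n expn_gt0 ltnW.
rewrite natrX lnXn // -[ln _ *+ _]mulr_natl.
have bp : (0 : R) < (4 * b)%:R by rewrite ltr0n muln_gt0.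
have {}h : (4 * b)%:R * (ln (n1%:R : R) * ln n2%:R) <= ln (N%:R : R) * ln 2.
  have := ler_wpM2r (ltW (mulr_gt0 bp (mulr_gt0 l2 l2))) h.
  rewrite /log2; move: (lt0r_neq0 bp) (lt0r_neq0 l2).
  move: (4 * b)%:R (ln 2) => B L B0 L0.
  have -> : B^-1 * (ln N%:R / L) * (B * (L * L)) = ln N%:R * L.
    by field; rewrite L0 B0.
  by congr (_ <= _); field; rewrite L0.
rewrite -(ler_pM2r l2); apply: le_trans h.
have := ler_wpM2l (ltW bp) (ler_wpM2r (ltW ln2) hj).
rewrite !natrM; lra.
Qed.

(* The hypothesis 0 < N makes log N meaningful; ln 0 is a junk value in the
   library. *)
Theorem theorem1p9 (R : realType) (H : sgraph) :
  exists c : R, 0 < c /\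
    forall (G : sgraph) (N n1 n2 : nat),
      #|G| = N -> (0 < N)%N -> (0 < n1)%N -> (0 < n2)%N ->
      induced_free H G ->
      log2 (n1%:R : R) * log2 (n2%:R : R) <= c * log2 (N%:R : R) ->
      (exists A : {set G}, clique A /\ #|A| = n1) \/
      (exists A : {set G}, independent A /\ #|A| = n2).
Proof.
(* [H] and its complement have the same order, so one [b] serves both cases. *)
pose b := ramsey_exp #|H|.
exists (4 * b)%:R^-1; split; first by rewrite invr_gt0 ltr0n.
move=> G N n1 n2 GN N0 n1_gt0 n2_gt0 HG hlog.
have /card_gt0P[x _] : (0 < #|G|)%N by rewrite GN.
have single y z : y \in [set x] -> z \in [set x] -> y = z.
  by rewrite !inE => /eqP-> /eqP->.
(* When a size is [1] its logarithm vanishes and the hypothesis gives no control on the other size,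
   but a single vertex suffices. *)
have [n1_gt1|] := ltnP 1 n1; last first.
  move=> n1_le1; have -> : n1 = 1%N by lia.
  left; exists [set x]; rewrite cards1; split=> // y z yx zx.
  by rewrite (single y z) ?eqxx.
have [n2_gt1|] := ltnP 1 n2; last first.
  move=> n2_le1; have -> : n2 = 1%N by lia.
  right; exists [set x]; rewrite cards1; split=> // y z yx zx.
  by rewrite (single y z) ?adj_irrefl.
have [n12|/ltnW n21] := leqP n1 n2.
  apply: (@clique_or_independent H) => //; rewrite GN.
  exact: pow_le_of_log hlog.
(* For [n2 <= n1] the two sizes exchange roles in the complement. *)
have [||||[A [cA sA]]|[A [iA sA]]] := @clique_or_independent (compl H) (compl G) n2 n1.
- exact: compl_free.
- by [].
- by [].
- by rewrite /= GN; rewrite mulrC in hlog; apply: pow_le_of_log hlog.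
- by right; exists A; split=> //; apply: compl_clique.
- by left; exists A; split=> //; apply: compl_independent.
Qed.
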